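(* Let $n\ge 2$, let $m\ge 1$ be an integer, and let $H_1,H_2\in B_n$ be half-twists with $H_1^m=H_2^m$. Then $H_1=H_2$.
   Context: $B_n$ is Artin's braid group with generators $\sigma_1,\dots,\sigma_{n-1}$ and relations $\sigma_i\sigma_j=\sigma_j\sigma_i$ for $|i-j|\ge 2$ and $\sigma_i\sigma_{i+1}\sigma_i=\sigma_{i+1}\sigma_i\sigma_{i+1}$. A half-twist is an element of the conjugacy class of $\sigma_1$ in $B_n$, i.e. an element $q^{-1}\sigma_1 q$ with $q\in B_n$. *)

(* Defs.v *)
From mathcomp Require Import all_boot.
Set Implicit Arguments. Unset Strict Implicit. Unset Printing Implicit Defensive.

(* A letter is a generator sigma_{i+1} (i : 'I_(n.-1)) with an inversion flag
   (false = sigma_{i+1}, true = sigma_{i+1}^-1). *)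
Definition letter (n : nat) := ('I_n.-1 * bool)%type.
Definition word (n : nat) := seq (letter n).

Definition inv_letter n (x : letter n) : letter n := (x.1, ~~ x.2).
Definition inv_word n (w : word n) : word n := rev (map (@inv_letter n) w).

Definition word_pow n (w : word n) (m : nat) : word n := flatten (nseq m w).

(* Equality in B_n: the smallest congruence on words (w.r.t. concatenation)
   containing free cancellation and the braid relations. *)
Inductive braid_eq (n : nat) : word n -> word n -> Prop :=
| be_refl u : braid_eq u u
| be_sym u v : braid_eq u v -> braid_eq v u
| be_trans u v w : braid_eq u v -> braid_eq v w -> braid_eq u w
| be_cat u u' v v' : braid_eq u u' -> braid_eq v v' -> braid_eq (u ++ v) (u' ++ v')
| be_free (x : letter n) : braid_eq [:: x; inv_letter x] [::]
| be_comm (i j : 'I_n.-1) : (i.+1 < j) || (j.+1 < i) ->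
    braid_eq [:: (i, false); (j, false)] [:: (j, false); (i, false)]
| be_braid (i j : 'I_n.-1) : val j = (val i).+1 ->
    braid_eq [:: (i, false); (j, false); (i, false)]
             [:: (j, false); (i, false); (j, false)].

Definition is_half_twist n (h : word n) : Prop :=
  exists (i : 'I_n.-1) (q : word n),
    val i = 0 /\ braid_eq h (inv_word q ++ [:: (i, false)] ++ q).

(* Main.v *)
Require Import Defs.
From mathcomp Require Import all_boot zify.
From Stdlib Require Import Setoid Morphisms.
Set Implicit Arguments. Unset Strict Implicit. Unset Printing Implicit Defensive.

(** Since [H1] and [H2] are conjugate to generators, the theorem says that
    [i^m q = q j^m] implies [i q = q j] for generators [i], [j] and a braid [q].
    The full twist [(s_1 ... s_(n-1))^n] is central and divisible by every
    generator, so multiplying by its powers reduces this to positive [q] and to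
    an equality in the positive braid monoid, which embeds in the group because
    it is left cancellative.  There one inducts on the length of [q = k q'].
    If [k = i] or [k] commutes with [i], cancel [k].  If [k] is adjacent to [i],
    then [lcm(i^m, k) = i^m k i] divides [i^m q], so [q = k i z] with
    [k^m z = z j^m], and the relation [i k i = k i k] transports the conclusion
    from [z] to [q].  Both cancellation and the lcm property are Garside's lemma
    [pos_eq_lcm_factor]. *)

(** * The positive braid monoid *)

Definition adj N (i j : 'I_N) : bool := (j == i.+1 :> nat) || (i == j.+1 :> nat).

(** Relations act at the head, before an arbitrary tail, so that a derivation can be followed
    through first letters; compatibility on the right is derived. *)
Inductive pos_eq (N : nat) : seq 'I_N -> seq 'I_N -> Prop :=
| pos_refl u : pos_eq u u
| pos_sym u v : pos_eq u v -> pos_eq v u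
| pos_trans u v w : pos_eq u v -> pos_eq v w -> pos_eq u w
| pos_cons i u v : pos_eq u v -> pos_eq (i :: u) (i :: v)
| pos_comm i j u : i != j -> ~~ adj i j -> pos_eq (i :: j :: u) (j :: i :: u)
| pos_braid i j u : adj i j -> pos_eq (i :: j :: i :: u) (j :: i :: j :: u).

Notation "u =+ v" := (pos_eq u v) (at level 70).

#[export] Hint Resolve pos_refl : core.

#[export] Instance pos_eq_equiv N : Equivalence (@pos_eq N).
Proof. split; [exact: pos_refl | exact: pos_sym | exact: pos_trans]. Qed.

#[export] Instance cons_pos_eq N :
  Proper (eq ==> @pos_eq N ==> @pos_eq N) (@cons 'I_N).
Proof. by move=> i _ <- u v; apply: pos_cons. Qed.

Lemma pos_eq_catr N (w u v : seq 'I_N) : u =+ v -> u ++ w =+ v ++ w.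
Proof.
elim=> {u v} [u|u v _ ?|u v t _ ? _ ?|i u v _ ?|i j u ? ?|i j u ?] /=.
- reflexivity.
- by symmetry.
- by transitivity (v ++ w).
- exact: pos_cons.
- exact: pos_comm.
- exact: pos_braid.
Qed.

#[export] Instance cat_pos_eq N :
  Proper (@pos_eq N ==> @pos_eq N ==> @pos_eq N) (@cat 'I_N).
Proof.
move=> u u' eu v v' ev; transitivity (u' ++ v); first exact: pos_eq_catr.
by elim: u' {eu} => //= i u' IH; apply: pos_cons.
Qed.

(** Lengths drive the later inductions; the set of letters serves to read off $i=j$ from
    $i^m=j^m$. *)
Lemma pos_eq_perm N (u v : seq 'I_N) : u =+ v -> size u = size v /\ u =i v.
Proof.
elim=> {u v} [//|u v _ [-> e]|u v w _ [-> e] _ [-> e']|i u v _ [e e']|i j u _ _|i j u _] //.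
- by split=> // x; rewrite e.
- by split=> // x; rewrite e.
- by split=> /= [|x]; rewrite ?e // !inE e'.
- by split=> // x; rewrite !inE orbCA.
- by split=> // x; rewrite !inE; do 2!case: eqP.
Qed.

Lemma pos_eq_size N (u v : seq 'I_N) : u =+ v -> size u = size v.
Proof. by case/pos_eq_perm. Qed.

Lemma adj_sym N (i j : 'I_N) : adj i j = adj j i.
Proof. by rewrite /adj orbC. Qed.

Lemma adj_neq N (i j : 'I_N) : adj i j -> i != j.
Proof. by apply: contraTneq => ->; rewrite /adj; lia. Qed.

(** The Coxeter graph is a path. A triangle would be of affine type, where three generators have no
    common multiple. *)
Lemma adj_triangle_free N (i j k : 'I_N) : adj i j -> adj j k -> ~~ adj i k.
Proof. rewrite /adj; lia. Qed.

(* The form of [x] and [y] when [i x = k y = lcm(i, k) z]. *)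
Definition lcm_factor N (i k : 'I_N) (x y : seq 'I_N) : Prop :=
  if i == k then x =+ y
  else if adj i k then exists z, x =+ k :: i :: z /\ y =+ i :: k :: z
  else exists z, x =+ k :: z /\ y =+ i :: z.

Definition head_compatible N (u v : seq 'I_N) : Prop :=
  match u, v with
  | [::], [::] => True
  | i :: x, k :: y => lcm_factor i k x y
  | _, _ => False
  end.

Lemma lcm_factor_sym N (i k : 'I_N) x y : lcm_factor i k x y -> lcm_factor k i y x.
Proof.
rewrite /lcm_factor eq_sym adj_sym; case: ifP => [_|_]; first by symmetry.
by case: ifP => _ [z [? ?]]; exists z.
Qed.

Lemma lcm_factor_eq N (i : 'I_N) x y : lcm_factor i i x y -> x =+ y.
Proof. by rewrite /lcm_factor eqxx. Qed.

Lemma lcm_factor_comm N (i k : 'I_N) x y : i != k -> ~~ adj i k ->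
  lcm_factor i k x y -> exists z, x =+ k :: z /\ y =+ i :: z.
Proof. by rewrite /lcm_factor => /negPf-> /negPf->. Qed.

Lemma lcm_factor_adj N (i k : 'I_N) x y : adj i k ->
  lcm_factor i k x y -> exists z, x =+ k :: i :: z /\ y =+ i :: k :: z.
Proof. by rewrite /lcm_factor => a; rewrite (negPf (adj_neq a)) a. Qed.

(** * Garside's lemma *)

Section Transitivity.
Variables (N L : nat).
Hypothesis IH : forall (i k : 'I_N) x y,
  i :: x =+ k :: y -> size x < L -> lcm_factor i k x y.

Let cancel (i : 'I_N) x y : i :: x =+ i :: y -> size x < L -> x =+ y.
Proof. by move=> e s; apply: (@lcm_factor_eq _ i); apply: IH. Qed.

Let comm (i k : 'I_N) x y : i != k -> ~~ adj i k -> i :: x =+ k :: y ->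
  size x < L -> exists z, x =+ k :: z /\ y =+ i :: z.
Proof. by move=> ? ? e s; apply: lcm_factor_comm => //; apply: IH. Qed.

Let braid (i k : 'I_N) x y : adj i k -> i :: x =+ k :: y ->
  size x < L -> exists z, x =+ k :: i :: z /\ y =+ i :: k :: z.
Proof. by move=> ? e s; apply: lcm_factor_adj => //; apply: IH. Qed.

Ltac sz := repeat match goal with H : pos_eq _ _ |- _ =>
  apply pos_eq_size in H; simpl in H end; rewrite /=; lia.

(** When the three letters are distinct, they span a finite Coxeter type. Applying [IH] to shorter
    words exhibits their common lcm as a left factor, and the lcm of [i] and [k] is split off from
    it. *)
Lemma lcm_factor_trans (i p k : 'I_N) x w y : size w <= L ->
  lcm_factor i p x w -> lcm_factor p k w y -> lcm_factor i k x y.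
Proof.
move=> sw.
have [<- /lcm_factor_eq xw|ip] := eqVneq i p.
  rewrite /lcm_factor; case: ifP => _; first by move=> <-.
  by case: ifP => _ [z [? ?]]; exists z; rewrite xw.
have [<- /[swap] /lcm_factor_eq wy|pk] := eqVneq p k.
  rewrite /lcm_factor; case: ifP => _; first by move=> ->.
  by case: ifP => _ [z [? ?]]; exists z; rewrite -wy.
move: pk; have [<- pk|ik pk] := eqVneq i k.
  case aip: (adj i p).
    have api : adj p i by rewrite adj_sym.
    case/(lcm_factor_adj aip) => z [xz wz] /(lcm_factor_adj api) [z' [wz' yz']].
    rewrite /lcm_factor eqxx xz yz'; do 2!apply: pos_cons.
    rewrite wz in wz'; apply: (@cancel p); last by sz.
    by apply: (@cancel i) => //=; sz.
  have api : ~~ adj p i by rewrite adj_sym aip.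
  case/(lcm_factor_comm ip (negbT aip)) => z [xz wz].
  case/(lcm_factor_comm pk api) => z' [wz' yz'].
  rewrite /lcm_factor eqxx xz yz'; apply: pos_cons.
  by rewrite wz in wz'; apply: (@cancel i) => //=; sz.
(* Exchanging [i] and [k] removes the case where [i] is adjacent to [p] while [p] commutes with
   [k]. *)
wlog sym : i k x y ip pk ik / adj i p -> adj p k.
  move=> W Fip Fpk; case apk: (adj p k); first by apply: (W i k).
  apply: lcm_factor_sym; apply: (W k i).
  1-3: by rewrite eq_sym.
  - by rewrite adj_sym apk.
  - exact: lcm_factor_sym.
  - exact: lcm_factor_sym.
case aip: (adj i p); case apk: (adj p k); try by rewrite sym in apk.
- have aik := adj_triangle_free aip apk.
  have aki : adj p i by rewrite adj_sym.
  case/(lcm_factor_adj aip) => z [xz wz] /(lcm_factor_adj apk) [z' [wz' yz']].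
  rewrite wz in wz'.
  have [|t [zt z't]] := comm ik aik wz'; first by sz.
  have [|s [zs ts]] := braid apk zt; first by sz.
  have [|r [z'r tr]] := braid aki z't; first by sz.
  rewrite ts in tr.
  have {}tr : k :: s =+ i :: r by apply: (@cancel p) => //; sz.
  have ki : k != i by rewrite eq_sym.
  have aki' : ~~ adj k i by rewrite adj_sym.
  have [|q [sq rq]] := comm ki aki' tr; first by sz.
  (* Type $A_3$ with middle node [p]: $p\,i\,k\,p$ completes $i\,k$ to the lcm of the three letters,
     of length 6. *)
  rewrite /lcm_factor (negPf ik) (negPf aik); exists (p :: i :: k :: p :: q).
  split.
    rewrite xz zs sq (pos_comm (p :: i :: q) ik aik) (pos_braid q aip).
    by rewrite (pos_braid _ apk) (pos_comm (p :: q) ki aki').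
  rewrite yz' z'r rq (pos_comm (p :: k :: q) ki aki') -(pos_braid q apk).
  by rewrite (pos_braid _ aki).
- case/(lcm_factor_comm ip (negbT aip)) => z [xz wz].
  case/(lcm_factor_adj apk) => z' [wz' yz']; rewrite wz in wz'.
  case aik: (adj i k).
    have [|t [zt z't]] := braid aik wz'; first by sz.
    have pi : p != i by rewrite eq_sym.
    have api : ~~ adj p i by rewrite adj_sym aip.
    have [|s [z's ts]] := comm pi api z't; first by sz.
    have akp : adj k p by rewrite adj_sym.
    have [|r [tr sr]] := braid akp ts; first by sz.
    (* Type $A_3$ with middle node [k]: $p\,k\,i$ completes $i\,k\,i$ to the lcm. *)
    rewrite /lcm_factor (negPf ik) aik; exists (p :: k :: i :: r); split.
      rewrite xz zt tr (pos_comm (k :: r) ip (negbT aip)) (pos_braid _ apk).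
      by rewrite -(pos_braid r aik) (pos_comm (k :: i :: r) pi api).
    rewrite yz' z's sr -(pos_braid _ aik) (pos_comm _ pi api).
    by rewrite (pos_comm r ip (negbT aip)) (pos_braid _ apk).
  have [|t [zt z't]] := comm ik (negbT aik) wz'; first by sz.
  have pi : p != i by rewrite eq_sym.
  have api : ~~ adj p i by rewrite adj_sym aip.
  have [|s [z's ts]] := comm pi api z't; first by sz.
  (* Type $A_1\times A_2$: the lcm is $i\,p\,k\,p = i\,k\,p\,k$. *)
  rewrite /lcm_factor (negPf ik) aik; exists (p :: k :: s); split.
    by rewrite xz zt ts (pos_braid _ apk).
  by rewrite yz' z's -(pos_comm _ ik (negbT aik)) (pos_comm _ pi api).
- case/(lcm_factor_comm ip (negbT aip)) => z [xz wz].
  case/(lcm_factor_comm pk (negbT apk)) => z' [wz' yz']; rewrite wz in wz'.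
  have pi : p != i by rewrite eq_sym.
  have api : ~~ adj p i by rewrite adj_sym aip.
  case aik: (adj i k).
    have [|t [zt z't]] := braid aik wz'; first by sz.
    rewrite /lcm_factor (negPf ik) aik; exists (p :: t); split.
      by rewrite xz zt (pos_comm _ pk (negbT apk)) (pos_comm _ pi api).
    by rewrite yz' z't (pos_comm _ pi api) (pos_comm _ pk (negbT apk)).
  have [|t [zt z't]] := comm ik (negbT aik) wz'; first by sz.
  rewrite /lcm_factor (negPf ik) aik; exists (p :: t); split.
    by rewrite xz zt (pos_comm _ pk (negbT apk)).
  by rewrite yz' z't (pos_comm _ pi api).
Qed.

End Transitivity.

Lemma pos_eq_head_compatible N (u v : seq 'I_N) : u =+ v -> head_compatible u v.
Proof.
have [L] := ubnP (size u); elim: L u v => // L IHL u v /[swap].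
elim=> {u v} [[|i u] _|u v uv IH s|u v w uv IH1 vw IH2 s
    |i u v uv _ _|i j u ij aij _|i j u aij _] //=.
- by rewrite /lcm_factor eqxx.
- move: IH; rewrite (pos_eq_size uv) => /(_ s).
  by case: u v {uv s} => [|i u] [|j v] //=; apply: lcm_factor_sym.
- have {IH1} := IH1 s; rewrite (pos_eq_size uv) in s.
  have {IH2} := IH2 s; case: u v w {uv vw} s => [|i u] [|p v] [|k w] //= s F2 F1.
  (* The middle tail [v] has length at most [L.-1], and tails shorter than [L.-1] belong to words
     shorter than [L], which [IHL] covers. *)
  apply: (@lcm_factor_trans _ L.-1 _ i p k u v w _ F1 F2); last by lia.
  by move=> a b x y e s'; apply: (IHL (a :: x) (b :: y)) e => /=; lia.
- by rewrite /lcm_factor eqxx.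
- by rewrite /lcm_factor (negPf ij) (negPf aij); exists u.
- rewrite /lcm_factor (negPf (adj_neq aij)) aij.
  by exists u.
Qed.

Lemma pos_eq_lcm_factor N (i k : 'I_N) x y :
  i :: x =+ k :: y -> lcm_factor i k x y.
Proof. exact: pos_eq_head_compatible. Qed.

(** * Cancellation and roots in the monoid *)

Lemma pos_eq_cancel N (w u v : seq 'I_N) : w ++ u =+ w ++ v -> u =+ v.
Proof. by elim: w => //= i w IH /pos_eq_lcm_factor/lcm_factor_eq/IH. Qed.

(* [lcm(i^m, k) = i^m k i] when [i] and [k] are adjacent. *)
Lemma pos_eq_pow_lcm N (i k : 'I_N) m x y : adj i k -> 0 < m ->
  nseq m i ++ x =+ k :: y -> exists z, x =+ k :: i :: z.
Proof.
move=> aik; elim: m y => // m IH y _ /= /pos_eq_lcm_factor/(lcm_factor_adj aik).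
by case=> z [e _]; case: m IH e => [_ /= e|m IH /IH]; [exists z | apply].
Qed.

Lemma pos_eq_pow_comm N (i k : 'I_N) m x : i != k -> ~~ adj i k ->
  nseq m i ++ k :: x =+ k :: nseq m i ++ x.
Proof.
move=> ik aik; elim: m => /= [|m ->]; first by [].
by rewrite (pos_comm _ ik aik).
Qed.

(** Iterates $i(ki)=(ki)k$. *)
Lemma pos_eq_pow_braid N (i k : 'I_N) m x : adj i k ->
  nseq m i ++ k :: i :: x =+ k :: i :: nseq m k ++ x.
Proof.
move=> aik; elim: m => /= [|m ->]; first by [].
by rewrite (pos_braid _ aik).
Qed.

Lemma nseq_cat_cons (T : Type) m (i : T) q : nseq m i ++ i :: q = i :: nseq m i ++ q.
Proof. by elim: m => //= m ->. Qed.

Lemma pos_eq_pow_root N (q : seq 'I_N) i j m : 0 < m ->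
  nseq m i ++ q =+ q ++ nseq m j -> i :: q =+ q ++ [:: j].
Proof.
move=> m_gt0; have [L] := ubnP (size q); elim: L q i => // L IH [|k q] i /=.
  move=> _ /pos_eq_perm[_ /(_ i)]; rewrite cats0 !mem_nseq m_gt0 eqxx => /esym/eqP->.
  by reflexivity.
rewrite ltnS => sq e; have [ik|ik] := eqVneq i k.
  rewrite -{k}ik in e *; apply: pos_cons; apply: IH => //.
  by apply: (@pos_eq_cancel _ [:: i]); rewrite /= -e nseq_cat_cons.
case aik: (adj i k); last first.
  rewrite (pos_comm _ ik (negbT aik)); apply: pos_cons; apply: IH => //.
  by apply: (@pos_eq_cancel _ [:: k]); rewrite /= -e pos_eq_pow_comm ?aik.
(* The remaining word [q] is $iz$; the induction hypothesis is used for [z], with [k] in place of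
   [i]. *)
have [z /(@pos_eq_cancel _ [:: k]) qz] := pos_eq_pow_lcm aik m_gt0 e.
rewrite qz (pos_braid _ aik) /=; do 2!apply: pos_cons; apply: IH.
  by move/pos_eq_size: qz sq => /= ->; lia.
apply: (@pos_eq_cancel _ [:: k; i]) => /=.
by rewrite -pos_eq_pow_braid // -qz e qz.
Qed.

(** * The Coxeter element and the full twist *)

Lemma pos_eq_word_comm N (i : 'I_N) w :
  all (fun j => (i != j) && ~~ adj i j) w -> i :: w =+ w ++ [:: i].
Proof.
by elim: w => //= j w IH /andP[/andP[ij aij] /IH <-]; apply: pos_comm.
Qed.

Definition word_iter (T : Type) (w : seq T) (m : nat) : seq T := flatten (nseq m w).

Lemma word_iterS (T : Type) (w : seq T) m : word_iter w m.+1 = w ++ word_iter w m.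
Proof. by []. Qed.

Lemma word_iterD (T : Type) (w : seq T) a b :
  word_iter w (a + b) = word_iter w a ++ word_iter w b.
Proof. by rewrite /word_iter nseqD flatten_cat. Qed.

Lemma pos_eq_iter_comm N (z w : seq 'I_N) m :
  z ++ w =+ w ++ z -> word_iter z m ++ w =+ w ++ word_iter z m.
Proof.
move=> zw; elim: m => [|m IH]; first by rewrite cats0.
by rewrite /word_iter /= -catA IH catA zw -catA.
Qed.

Lemma pos_eq_shift N (u v w : seq 'I_N) i j :
  u ++ [:: i] =+ j :: v -> u ++ i :: w =+ j :: v ++ w.
Proof. by move=> e; rewrite -cat1s catA e. Qed.

Section Coxeter.
Variable k : nat.

(** Natural indices allow shifting by arithmetic; [inord] is faithful only up to [k], hence the
    bounds below. *)
Definition gen (i : nat) : 'I_k.+1 := inord i.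
Local Notation s := gen.

Definition coxeter : seq 'I_k.+1 := map s (iota 0 k.+1).

(** The letter $s_i$ moves left past everything after $s_{i+1}$, a braid relation turns it into
    $s_{i+1}$, and this moves left past everything before $s_i$. *)
Lemma coxeter_shift i : i < k -> coxeter ++ [:: s i] =+ s i.+1 :: coxeter.
Proof.
move=> ik; have sK j : j <= k -> s j = j :> nat by move=> jk; rewrite inordK.
have -> : coxeter = map s (iota 0 i) ++ [:: s i, s i.+1 & map s (iota i.+2 (k.-1 - i))].
  have e : iota 0 k.+1 = iota 0 i ++ iota (0 + i) (2 + (k.-1 - i)).
    by rewrite -iotaD; congr iota; lia.
  by rewrite /coxeter e map_cat.
have a : adj (s i) (s i.+1) by rewrite /adj !sK ?eqxx //; lia.
rewrite -catA /= -pos_eq_word_comm; last first.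
  apply/allP => _ /mapP[j + ->]; rewrite mem_iota => j_lim.
  by rewrite -val_eqE /= /adj !sK; lia.
rewrite (pos_braid _ a) -[s i.+1 :: map s _ ++ _]cat_cons.
rewrite (@pos_eq_word_comm _ (s i.+1) (map s (iota 0 i))).
  by rewrite -catA.
apply/allP => _ /mapP[j + ->]; rewrite mem_iota => j_lim.
by rewrite -val_eqE /= /adj !sK; lia.
Qed.

Lemma coxeter_shift_iota i r : i + r <= k ->
  coxeter ++ map s (iota i r) =+ map s (iota i.+1 r) ++ coxeter.
Proof.
elim: r i => [|r IH] i; first by rewrite /= cats0.
move=> ir; rewrite ![iota _ r.+1]/= !map_cons cat_cons.
rewrite (pos_eq_shift _ (coxeter_shift _)); last by lia.
by rewrite IH //; lia.
Qed.

Lemma coxeter_iter_shift i r : i + r <= k ->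
  word_iter coxeter r ++ [:: s i] =+ s (i + r) :: word_iter coxeter r.
Proof.
elim: r => [|r IH] ir; first by rewrite addn0.
rewrite !word_iterS -catA IH; last by lia.
by rewrite (pos_eq_shift _ (coxeter_shift _)) ?addnS //; lia.
Qed.

(** With $c$ the Coxeter element, $s_0c^2=s_0\,c\,(s_0\cdots s_{k-1})s_k=s_0(s_1\cdots
    s_k)\,c\,s_k=c^2s_k$. This closes the cycle of shifts. *)
Lemma coxeter_square_shift :
  word_iter coxeter 2 ++ [:: s k] =+ s 0 :: word_iter coxeter 2.
Proof.
have e1 : coxeter = map s (iota 0 k) ++ [:: s k].
  have e : iota 0 k.+1 = iota 0 k ++ [:: k] by rewrite -[k.+1]addn1 iotaD.
  by rewrite /coxeter e map_cat.
have e2 : coxeter = s 0 :: map s (iota 1 k) by [].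
rewrite !word_iterS cats0 [X in _ =+ _ :: _ ++ X]e1.
by rewrite [X in _ =+ _ :: X]catA coxeter_shift_iota // -!catA -cat_cons -e2.
Qed.

Definition full_twist : seq 'I_k.+1 := word_iter coxeter k.+2.

(** The cofactor of $s_i$, obtained from $s_ic^i=c^is_0$ and $s_0(s_1\cdots s_k)=c$. *)
Definition full_twist_div (i : 'I_k.+1) : seq 'I_k.+1 :=
  word_iter coxeter i ++ map s (iota 1 k) ++ word_iter coxeter (k.+1 - i).

(** Split the exponent as $i+2+(k-i)$: passing leftwards, $s_i$ becomes $s_k$, then $s_0$, then
    $s_i$ again. *)
Lemma full_twist_central_gen i : full_twist ++ [:: i] =+ i :: full_twist.
Proof.
have ik : i <= k by rewrite -ltnS.
have -> : i = s i by rewrite /gen inord_val.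
rewrite /full_twist; set j := nat_of_ord i in ik *.
have -> : k.+2 = j + (2 + (k - j)) by lia.
move: coxeter_square_shift; rewrite !word_iterD.
move: (word_iter coxeter 2) => sq sq_shift.
rewrite -!catA coxeter_iter_shift ?subnKC //.
by rewrite (pos_eq_shift _ sq_shift) (pos_eq_shift _ (coxeter_iter_shift _)).
Qed.

Lemma full_twist_central w : full_twist ++ w =+ w ++ full_twist.
Proof.
elim: w => [|i w IH]; first by rewrite cats0.
by rewrite (pos_eq_shift _ (full_twist_central_gen i)) IH.
Qed.

Lemma full_twist_divl i : i :: full_twist_div i =+ full_twist.
Proof.
have ik : i <= k by rewrite -ltnS.
have := @coxeter_iter_shift 0 i ik; rewrite add0n /gen inord_val => e.
rewrite /full_twist_div -cat_cons -e /full_twist.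
have -> : k.+2 = i + (1 + (k.+1 - i)) by lia.
by rewrite !word_iterD -!catA.
Qed.

Lemma full_twist_divr i : full_twist_div i ++ [:: i] =+ full_twist.
Proof.
apply: (@pos_eq_cancel _ [:: i]).
by rewrite catA [[:: i] ++ _]/= full_twist_divl full_twist_central.
Qed.

End Coxeter.

(** * Words in the braid group *)

#[export] Instance braid_eq_equiv n : Equivalence (@braid_eq n).
Proof. split; [exact: be_refl | exact: be_sym | exact: be_trans]. Qed.

#[export] Instance cat_braid_eq n :
  Proper (@braid_eq n ==> @braid_eq n ==> @braid_eq n) (@cat (letter n)).
Proof. by move=> u u' eu v v' ev; apply: be_cat. Qed.

#[export] Hint Resolve be_refl : core.

Notation "u =b v" := (braid_eq u v) (at level 70).

Lemma inv_letterK n : involutive (@inv_letter n).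
Proof. by case=> i b; rewrite /inv_letter /= negbK. Qed.

Lemma inv_wordK n : involutive (@inv_word n).
Proof.
by move=> w; rewrite /inv_word map_rev revK -map_comp map_id_in // => x _; apply: inv_letterK.
Qed.

Lemma mul_word_inv n (w : word n) : w ++ inv_word w =b [::].
Proof.
elim: w => //= x w IH; rewrite /inv_word map_cons rev_cons -cats1.
rewrite -cat1s [X in _ ++ X]catA IH; exact: be_free.
Qed.

Lemma mul_inv_word n (w : word n) : inv_word w ++ w =b [::].
Proof. by rewrite -{2}[w]inv_wordK mul_word_inv. Qed.

Lemma braid_eq_cancel n (w u v : word n) : w ++ u =b w ++ v -> u =b v.
Proof.
move=> e; rewrite -[u]cat0s -[v]cat0s -(mul_inv_word w) -!catA.
by rewrite e.
Qed.

Definition pos_word n (u : seq 'I_n.-1) : word n := [seq (i, false) | i <- u].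

Lemma pos_word_cat n (u v : seq 'I_n.-1) :
  pos_word (u ++ v) = pos_word u ++ pos_word v.
Proof. exact: map_cat. Qed.

Lemma pos_eq_braid_eq n (u v : seq 'I_n.-1) : u =+ v -> pos_word u =b pos_word v.
Proof.
elim=> {u v} [u|u v _ ?|u v t _ ? _ ?|i u v _ e|i j u ij aij|i j u aij] /=.
- by [].
- by symmetry.
- by transitivity (pos_word v).
- by rewrite /pos_word /= -cat1s -[X in _ =b X]cat1s; apply: be_cat.
- apply: (@be_cat _ [:: _; _] [:: _; _] _ _ _ (be_refl _)); apply: be_comm.
  by move: ij aij; rewrite -val_eqE /= /adj; lia.
- apply: (@be_cat _ [:: _; _; _] [:: _; _; _] _ _ _ (be_refl _)).
  by case/orP: aij => /eqP e; [|symmetry]; apply: be_braid.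
Qed.

(** * Embedding of the monoid in the group *)

Section Embedding.
Variable k : nat.
Notation n := k.+2.

Definition neg_count (w : word n) : nat := count snd w.

(* The product of [w] with the [neg_count w]-th power of the full twist. *)
Definition pos_part (w : word n) : seq 'I_k.+1 :=
  flatten [seq if x.2 then full_twist_div x.1 else [:: x.1] | x <- w].

Definition twists (m : nat) : seq 'I_k.+1 := word_iter (full_twist k) m.

Lemma twists_central m w : twists m ++ w =+ w ++ twists m.
Proof. exact/pos_eq_iter_comm/full_twist_central. Qed.

Lemma neg_count_cat u v : neg_count (u ++ v) = neg_count u + neg_count v.
Proof. exact: count_cat. Qed.

Lemma pos_part_cat u v : pos_part (u ++ v) = pos_part u ++ pos_part v.
Proof. by rewrite /pos_part map_cat flatten_cat. Qed.

(** A word stands for a fraction: its [pos_part] over the power of the full twist counted by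
    [neg_count]. The conclusion is equality of fractions, cross-multiplied. *)
Lemma braid_eq_pos_part (u v : word n) : u =b v ->
  twists (neg_count v) ++ pos_part u =+ twists (neg_count u) ++ pos_part v.
Proof.
elim=> {u v} [u|u v _ ?|u v w _ e1 _ e2|u u' v v' _ e1 _ e2|[i b]|i j ij|i j ij].
- by [].
- by symmetry.
(* As for fractions, transitivity multiplies by the middle denominator and then cancels it. *)
- apply: (@pos_eq_cancel _ (twists (neg_count v))).
  rewrite catA -word_iterD addnC word_iterD -catA e1.
  rewrite catA -word_iterD addnC word_iterD -catA e2.
  by rewrite catA -word_iterD addnC word_iterD -catA.
- rewrite !neg_count_cat !pos_part_cat /twists !word_iterD -!/(twists _).
  transitivity ((twists (neg_count u') ++ pos_part u) ++
                (twists (neg_count v') ++ pos_part v)).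
    by rewrite -!catA [twists (neg_count v') ++ pos_part u ++ _]catA
      (twists_central (neg_count v') (pos_part u)) -catA.
  rewrite e1 e2 -!catA [pos_part u' ++ twists (neg_count v) ++ _]catA.
  by rewrite -(twists_central (neg_count v) (pos_part u')) -catA.
- by case: b; rewrite /twists /word_iter /pos_part /= !cats0;
    [apply: full_twist_divr | apply: full_twist_divl].
- rewrite /pos_part /=; apply: pos_comm; move: ij; rewrite -?val_eqE /adj /=; lia.
- by rewrite /pos_part /=; apply: pos_braid; rewrite /adj ij eqxx.
Qed.

(** Each negative letter absorbs one full twist, leaving its cofactor; positive letters let the
    central twists pass. *)
Lemma twists_pos_part (w : word n) :
  @pos_word n (twists (neg_count w)) ++ w =b @pos_word n (pos_part w).
Proof.
elim: w => // [[i []] w] IH.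
  have e : twists (neg_count w).+1 =+ (full_twist_div i ++ twists (neg_count w)) ++ [:: i].
    rewrite -catA twists_central catA full_twist_divr; exact: pos_refl.
  rewrite -[neg_count _]/(neg_count w).+1 (pos_eq_braid_eq (n := n) e).
  rewrite 2!(@pos_word_cat n) -!catA.
  have f : @pos_word n [:: i] ++ (i, true) :: w =b w.
    exact: (be_cat (be_free (i, false)) (be_refl w)).
  by rewrite f IH -pos_word_cat.
rewrite -[neg_count _]/(neg_count w) -cat1s catA -[[:: (i, false)]]/(@pos_word n [:: i]).
rewrite -pos_word_cat (pos_eq_braid_eq (n := n) (twists_central _ _)).
by rewrite pos_word_cat -catA IH -pos_word_cat.
Qed.

(** Positive words have denominator 1 and are their own numerators. *)
Lemma pos_word_braid_eq (u v : seq 'I_n.-1) : @pos_word n u =b pos_word v -> u =+ v.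
Proof.
have negw w : neg_count (pos_word w) = 0 by rewrite /neg_count; elim: w.
have posw w : pos_part (pos_word w) = w.
  by rewrite /pos_part; elim: w => //= i w ->.
by move/braid_eq_pos_part; rewrite !negw !posw.
Qed.


(* Multiplying [q] by a central power of the full twist makes it positive. *)
Lemma braid_eq_pow_root (q : word n) (i j : 'I_n.-1) m : 0 < m ->
  nseq m (i, false) ++ q =b q ++ nseq m (j, false) ->
  [:: (i, false)] ++ q =b q ++ [:: (j, false)].
Proof.
move=> m_gt0 e; set z := @pos_word n (twists (neg_count q)).
have zC u : z ++ @pos_word n u =b @pos_word n u ++ z.
  by rewrite -!pos_word_cat; apply/pos_eq_braid_eq/twists_central.
(* Since [z] is central on positive words and $zq$ is the positive part of [q], both intertwine the
   same positive words. *)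
have conj u v : @pos_word n u ++ q =b q ++ @pos_word n v <->
    u ++ pos_part q =+ pos_part q ++ v.
  split=> [uv|/(@pos_eq_braid_eq n)].
    apply: pos_word_braid_eq; rewrite !pos_word_cat -twists_pos_part.
    by rewrite catA -zC -!catA uv.
  rewrite !pos_word_cat -twists_pos_part catA -zC -!catA.
  exact: braid_eq_cancel.
apply/(conj [:: i] [:: j])/pos_eq_pow_root/(conj (nseq m i) (nseq m j)); first exact: m_gt0.
by rewrite /pos_word !map_nseq.
Qed.

End Embedding.

(** * Half-twists as conjugates of generators *)

Lemma word_pow_conj n (h q : word n) x m : h =b inv_word q ++ [:: x] ++ q ->
  word_pow h m =b inv_word q ++ nseq m x ++ q.
Proof.
move=> e; elim: m => [|m IH]; first by rewrite /word_pow /= mul_inv_word.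
rewrite -[word_pow h m.+1]/(h ++ word_pow h m) IH e -!catA.
by rewrite [q ++ inv_word q ++ _]catA mul_word_inv.
Qed.

(** Merges the two conjugators into the single braid $pq^{-1}$, to which [braid_eq_pow_root]
    applies. *)
Lemma conj_eq_iff n (a b p q : word n) :
  inv_word p ++ a ++ p =b inv_word q ++ b ++ q <->
  a ++ p ++ inv_word q =b (p ++ inv_word q) ++ b.
Proof.
split=> e.
  apply: (@braid_eq_cancel _ (inv_word p)).
  rewrite [a ++ _]catA [inv_word p ++ _ ++ _]catA e -!catA mul_word_inv cats0.
  by rewrite [inv_word p ++ _ ++ _]catA mul_inv_word.
rewrite -[X in a ++ X]cats0 -(mul_inv_word q).
rewrite [p ++ inv_word q ++ q]catA [a ++ _ ++ _]catA e -!catA.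
by rewrite [inv_word p ++ _ ++ _]catA mul_inv_word.
Qed.

Theorem theorem2p11 (n : nat) (hn : 2 <= n) (m : nat) (hm : 1 <= m)
  (H1 H2 : word n) :
  is_half_twist H1 -> is_half_twist H2 ->
  braid_eq (word_pow H1 m) (word_pow H2 m) -> braid_eq H1 H2.
Proof.
case: n hn H1 H2 => [|[|k]] // _ H1 H2 [i [p [_ e1]]] [j [q [_ e2]]].
rewrite (word_pow_conj m e1) (word_pow_conj m e2) e1 e2 => /conj_eq_iff e.
exact/conj_eq_iff/(braid_eq_pow_root hm).
Qed.
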